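(* Let $K$ be a field, $R=K[x_1,\dots,x_n]$, and let $I\subseteq R$ be an arbitrary monomial ideal. Let $\mathbf a\in\mathbb N^n$ and let $k\ge 1$ be an integer. Then (i) $x^{\mathbf a}\in I^k$ if and only if $\nu_{\mathbf a}(I)\ge k$; (ii) $x^{\mathbf a}\in\overline{I^k}$ if and only if $\nu^*_{\mathbf a}(I)\ge k$.
   Context: $\mathbb N$ includes $0$; $x^{\mathbf a}=x_1^{\alpha_1}\cdots x_n^{\alpha_n}$ for $\mathbf a=(\alpha_1,\dots,\alpha_n)$. $\overline{J}$ denotes the integral closure of an ideal $J$. Let $x^{\mathbf a_1},\dots,x^{\mathbf a_m}$ be the minimal monomial generators of $I$; the exponent matrix $M$ of $I$ is the $n\times m$ matrix with columns $\mathbf a_1,\dots,\mathbf a_m$. Let $\mathbf 1^m=(1,\dots,1)\in\mathbb N^m$. Vector inequalities are coordinatewise. Define $$\nu_{\mathbf a}(I)=\max\{\mathbf 1^m\cdot\mathbf y\mid \mathbf y\in\mathbb N^m,\ M\mathbf y\le\mathbf a\},\qquad \nu^*_{\mathbf a}(I)=\max\{\mathbf 1^m\cdot\mathbf y\mid \mathbf y\in\mathbb R_{\ge0}^m,\ M\mathbf y\le\mathbf a\},$$ with the convention that these values are $+\infty$ when $I=R$ (and they are $0$ when $I=0$). *)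

(* Defs.v *)
From HB Require Import structures.
From mathcomp Require Import all_boot all_order all_algebra.
From mathcomp Require Import boolp classical_sets reals constructive_ereal.
(* The notations of mpoly are incompatible with those of boolp; without them,
   [mpoly n K] is K[x_1, .., x_n], [multinom n] is the type of exponent vectors
   in N^n, and [mpolyX K a] is the monomial x^a. *)
From mathcomp Require Export -(notations) mpoly.

Set Implicit Arguments.
Unset Strict Implicit.
Unset Printing Implicit Defensive.

Import Order.TTheory GRing.Theory Num.Theory.

Local Open Scope classical_set_scope.
Local Open Scope ring_scope.

Section Ideals.
Variable A : comNzRingType.
Implicit Types (S J : set A) (f : A).

Definition ideal_gen S : set A :=
  [set f | exists (m : nat) (c s : 'I_m -> A),
    (forall i, S (s i)) /\ f = \sum_(i < m) c i * s i].

(* For k = 0 the only generator is the empty product, so that J^0 = (1). *)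
Definition ideal_pow J (k : nat) : set A :=
  ideal_gen [set f | exists g : 'I_k -> A,
    (forall i, J (g i)) /\ f = \prod_(i < k) g i].

Definition integral_closure J : set A :=
  [set f | exists (d : nat) (c : nat -> A),
    [/\ (0 < d)%N,
        forall i, (1 <= i <= d)%N -> ideal_pow J i (c i) &
        f ^+ d + \sum_(1 <= i < d.+1) c i * f ^+ (d - i) = 0]].

End Ideals.

Section MonomialIdeals.
Variables (K : fieldType) (n : nat).
Implicit Types (G : set (multinom n)) (I : set (mpoly n K)).

Definition monomial_gen G : set (mpoly n K) := ideal_gen (mpolyX K @` G).

Definition monomial_ideal I : Prop := exists G, I = monomial_gen G.

Definition minimal_monomial_generators I G : Prop :=
  I = monomial_gen G /\
  forall G', G' `<=` G -> I = monomial_gen G' -> G' = G.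

Definition is_exponent_matrix I m (M : 'M[nat]_(n, m)) : Prop :=
  injective (fun j => col j M) /\
  minimal_monomial_generators I
    [set a : multinom n | exists j, forall i, a i = M i j].

(* The exponent matrix is unique up to the order of its columns, on which the
   values [nu] and [nustar] below do not depend; some order is chosen here.
   An exponent matrix exists whenever I is a monomial ideal, since I then has a
   unique minimal set of monomial generators, and it is finite (Dickson); the
   default value of [xget] is only relevant to other sets I. *)
Definition exponent_matrix I : {m : nat & 'M[nat]_(n, m)} :=
  xget (Tagged (fun m => 'M[nat]_(n, m)) (0 : 'M[nat]_(n, 0)))
    [set M | is_exponent_matrix I (tagged M)].

End MonomialIdeals.

(* The greatest element of B, or x0 if B has none. *)
Definition set_max d (T : porderType d) (x0 : T) (B : set T) : T :=
  xget x0 [set x | B x /\ ubound B x].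

Section PackingNumbers.
Variables (K : fieldType) (n : nat).
Implicit Types (I : set (mpoly n K)) (a : multinom n).

Definition packing_values m (M : 'M[nat]_(n, m)) a : set nat :=
  [set s | exists y : 'cV[nat]_m,
    (forall i, ((M *m y) i ord0 <= a i)%N) /\ s = (\sum_(j < m) y j ord0)%N].

Definition fractional_packing_values (R : realType) m (M : 'M[nat]_(n, m)) a :
    set R :=
  [set s | exists y : 'cV[R]_m,
    [/\ forall j, 0 <= y j ord0,
        forall i, (map_mx (fun e : nat => e%:R) M *m y) i ord0 <= (a i)%:R &
        s = \sum_(j < m) y j ord0]].

(* N together with +oo is embedded in the ordered type [\bar int]. *)
Definition nu I a : \bar int :=
  if `[< I = setT >] then +oo%E
  else (Posz (set_max 0%N (packing_values (tagged (exponent_matrix I)) a)))%:E.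

Definition nustar (R : realType) I a : \bar R :=
  if `[< I = setT >] then +oo%E
  else (set_max 0
    (fractional_packing_values (R := R) (tagged (exponent_matrix I)) a))%:E.

End PackingNumbers.

(* Main.v *)
(* A polynomial lies in a monomial ideal iff all its monomials do, and x^b lies
   in I^s iff b dominates a sum of s columns of M, that is, iff s is a value of
   the integer packing program of b.  If x^a is integral over I^k, the
   coefficient of x^(d a) in the integral equation of degree d yields an i >= 1
   such that x^(i a) is in I^(i k); dividing the packing by i gives a fractional
   one.  Conversely, approximate a real packing y with N y close to an integer
   vector p (Dirichlet): as M, a and k are integral, M p <= N a and
   |p| >= N k hold exactly once the errors sum to less than 1, so that
   (x^a)^N is in (I^k)^N.  Both maxima exist because no column of M is zero when
   I is proper: the real program is then compact.  Finiteness of the exponent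
   matrix is Dickson's lemma. *)
Require Import Defs.
From mathcomp Require Import all_boot all_order all_algebra.
From mathcomp Require Import boolp classical_sets reals constructive_ereal.
From mathcomp Require Import topology matrix_normedtype normedtype derive.

Set Implicit Arguments.
Unset Strict Implicit.
Unset Printing Implicit Defensive.

Import Order.TTheory GRing.Theory Num.Theory.
Import numFieldNormedType.Exports.

Local Open Scope classical_set_scope.
Local Open Scope ring_scope.

(** * Ideals and powers of monomial ideals *)

Section Ideals.
Variable A : comNzRingType.
Implicit Types (S J : set A) (f : A).

Lemma sub_ideal_gen S f : S f -> ideal_gen S f.
Proof.
move=> Sf; exists 1%N, (fun=> 1), (fun=> f); split=> //.
by rewrite big_ord1 mul1r.
Qed.

Lemma ideal_gen0 S : ideal_gen S 0.
Proof. by exists 0%N, (fun=> 0), (fun=> 0); split=> [[]|] //; rewrite big_ord0. Qed.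

Lemma ideal_genM S c f : ideal_gen S f -> ideal_gen S (c * f).
Proof.
move=> [m [d [s [Ss ->]]]]; exists m, (fun i => c * d i), s; split=> //.
by rewrite mulr_sumr; apply: eq_bigr => i _; rewrite mulrA.
Qed.

Lemma ideal_gen1 S : ideal_gen S 1 -> ideal_gen S = setT.
Proof.
by move=> S1; apply/seteqP; split=> // f _; rewrite -[f]mulr1; apply: ideal_genM.
Qed.

Lemma ideal_powT J k : J = setT -> ideal_pow J k = setT.
Proof.
move=> ->; apply: ideal_gen1; apply: sub_ideal_gen.
by exists (fun=> 1); split=> //; rewrite big1.
Qed.

(** The element f is a root of X^d - f^d, an integral equation whose only non-zero lower coefficient
    is the constant one. *)
Lemma integral_closure_pow J d f :
  (0 < d)%N -> ideal_pow J d (f ^+ d) -> integral_closure J f.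
Proof.
case: d => // d _ Jf; exists d.+1, (fun i => if i == d.+1 then - f ^+ d.+1 else 0).
split=> // [i _|].
  case: eqP => [->|_]; last exact: ideal_gen0.
  by rewrite -mulN1r; apply: ideal_genM.
rewrite big_nat_recr //= eqxx subnn expr0 mulr1 big_nat big1 ?add0r ?subrr //.
by move=> i /andP[_ id]; rewrite ltn_eqF ?mul0r.
Qed.

End Ideals.

(** [z] grows by one unit at a time: while its sum is below that of [y], some coordinate has
    room. *)
Lemma sub_sum_eq (T : finType) (y : T -> nat) s : (s <= \sum_j y j)%N ->
  exists z : T -> nat, (forall j, z j <= y j)%N /\ (\sum_j z j = s)%N.
Proof.
elim: s => [_|s IHs sy].
  by exists (fun=> 0%N); split=> //; rewrite big1.
have [z [zy zs]] := IHs (ltnW sy).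
have [j zyj] : exists j, (z j < y j)%N.
  apply/existsP; apply: contraLR sy => /existsPn yz.
  by rewrite -leqNgt -zs; apply: leq_sum => j _; rewrite leqNgt.
exists (fun i => z i + (i == j))%N; split=> [i|].
  by case: eqP => [->|_]; rewrite ?addn1 ?addn0.
by rewrite big_split /= zs -big_mkcond /= big_pred1_eq addn1.
Qed.

(** * Integer packings and powers of ideals *)

Section Packing.
Variables (n m : nat) (M : 'M[nat]_(n, m)).
Implicit Types (b c : multinom n).

Lemma mulmx_nat_colE (y : 'cV[nat]_m) i :
  (M *m y) i ord0 = (\sum_(j < m) M i j * y j ord0)%N.
Proof. by rewrite mxE. Qed.

Lemma packing_values0 b : packing_values M b 0.
Proof.
exists 0; split=> [i|]; first by rewrite mulmx0 mxE.
by rewrite big1 // => j _; rewrite mxE.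
Qed.

Lemma packing_values_le b c s :
  (forall i, b i <= c i)%N -> packing_values M b s -> packing_values M c s.
Proof.
by move=> bc [y [Mb ys]]; exists y; split=> // i; apply: leq_trans (bc i).
Qed.

Lemma packing_valuesD b c s t : packing_values M b s ->
  packing_values M c t -> packing_values M (mnm_add b c) (s + t)%N.
Proof.
move=> [y [Mb ->]] [z [Mc ->]]; exists (y + z); split=> [i|].
  by rewrite mulmxDr mxE mnmDE leq_add.
by rewrite -big_split; apply: eq_bigr => j _; rewrite mxE.
Qed.

(** A part [u] of the packing with entry sum [s] is split off. Giving it exactly the exponent M u
    leaves enough of [b] for the other part. This is how monomials in powers of ideals get
    factored. *)
Lemma packing_values_split b s t : packing_values M b (s + t)%N ->
  exists c d, [/\ packing_values M c s, packing_values M d t & b = mnm_add c d].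
Proof.
move=> [y [Mb sy]].
have [|z [zy zs]] := @sub_sum_eq _ (fun j => y j ord0) s.
  by rewrite -sy leq_addr.
pose u : 'cV[nat]_m := \col_j z j; pose v : 'cV[nat]_m := \col_j (y j ord0 - z j)%N.
have uv : u + v = y.
  by apply/matrixP => j k; rewrite ord1 !mxE; apply: subnKC (zy j).
have us : (\sum_(j < m) u j ord0)%N = s.
  by rewrite -zs; apply: eq_bigr => j _; rewrite mxE.
have Mu i : ((M *m u) i ord0 <= b i)%N.
  by apply: leq_trans (Mb i); rewrite -uv mulmxDr [leqRHS]mxE leq_addr.
pose c := Multinom [tuple (M *m u) i ord0 | i < n].
have cE i : c i = (M *m u) i ord0 by rewrite mnmE.
exists c, (mnm_sub b c); split.
- by exists u; split=> // i; rewrite cE.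
- exists v; split=> [i|].
    by rewrite mnmBE cE leq_subRL // (leq_trans _ (Mb i)) // -uv mulmxDr [leqRHS]mxE.
  apply/eqP; rewrite -(eqn_add2l s) sy -{1}us -big_split /=; apply/eqP.
  by apply: eq_bigr => j _; rewrite -{1}uv mxE.
- by apply/mnmP => i; rewrite mnmDE mnmBE cE subnKC.
Qed.

Lemma packing_values_geq b s t :
  (t <= s)%N -> packing_values M b s -> packing_values M b t.
Proof.
move=> /subnKC <- /packing_values_split[c [d [pc _ ->]]].
by apply: packing_values_le pc => i; rewrite mnmDE leq_addr.
Qed.

Lemma packing_values1 b :
  packing_values M b 1 <-> exists j, forall i, (M i j <= b i)%N.
Proof.
split=> [[y [Mb sy]]|[j Mb]].
  have [j yj] : exists j, (0 < y j ord0)%N.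
    apply/existsP; apply: contra_eqT sy => /existsPn y0.
    by rewrite big1 // => j _; apply/eqP; rewrite -leqn0 leqNgt.
  exists j => i; apply: leq_trans (Mb i); rewrite mulmx_nat_colE (bigD1 j) //=.
  by rewrite (leq_trans _ (leq_addr _ _)) // leq_pmulr.
exists (\col_k (k == j : nat)); split=> [i|].
  rewrite mulmx_nat_colE (bigD1 j) //= mxE eqxx muln1 big1 ?addn0 // => k kj.
  by rewrite mxE (negPf kj) muln0.
by rewrite (bigD1 j) //= mxE eqxx big1 // => k kj; rewrite mxE (negPf kj).
Qed.

Variable K : fieldType.
Implicit Types (S J : set (mpoly n K)) (f g : mpoly n K).

(** Multiplication by a polynomial only raises exponents: each monomial of the multiplier adds a
    packing of size 0. *)
Lemma msupp_ideal_gen S s :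
  (forall f, S f -> forall b, b \in msupp f -> packing_values M b s) ->
  forall f, ideal_gen S f -> forall b, b \in msupp f -> packing_values M b s.
Proof.
move=> Ss _ [r [c [h [Sh ->]]]] b /msupp_sum_le /flatten_mapP[i _].
move=> /msuppM_le /allpairsP[[u v] /= [_ hv ->]].
by rewrite -[s]add0n; apply: packing_valuesD (packing_values0 u) (Ss _ (Sh i) _ hv).
Qed.

(** The size [s] per factor is left general: [s = 1] serves the powers of I, [s = k] the powers of
    I^k in an integral equation. *)
Lemma msupp_ideal_pow J s k :
  (forall f, J f -> forall b, b \in msupp f -> packing_values M b s) ->
  forall f, ideal_pow J k f ->
  forall b, b \in msupp f -> packing_values M b (k * s)%N.
Proof.
move=> Js; apply: msupp_ideal_gen => _ [g [Jg ->]].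
elim: k => [|k IHk] in g Jg *; first by move=> b _; apply: packing_values0.
rewrite big_ord_recl => b /msuppM_le /allpairsP[[u v] /= [gu gv ->]].
apply: packing_valuesD (Js _ (Jg ord0) _ gu) (IHk _ _ _ gv) => i.
exact: Jg.
Qed.

Lemma mpolyX_ideal_pow J s k :
  (forall b, packing_values M b s -> J (mpolyX K b)) ->
  forall b, packing_values M b (k * s)%N -> ideal_pow J k (mpolyX K b).
Proof.
move=> Js b pb.
(* Splitting the packing [k] times peels off [k] monomials of [J]; [r] is the monomial left over. *)
have [g [Jg [r ->]]] : exists g : 'I_k -> mpoly n K, (forall i, J (g i)) /\
    exists r, mpolyX K b = r * \prod_(i < k) g i.
  elim: k => [|k IHk] in b pb *.
    by exists (fun=> 0); split=> [[]//|]; exists (mpolyX K b); rewrite big_ord0 mulr1.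
  have [c [d [pc pd ->]]] := packing_values_split pb.
  have [g [Jg [r gE]]] := IHk _ pd.
  exists (fun i => oapp g (mpolyX K c) (unlift ord0 i)); split=> [i|].
    by case: unliftP => [j _|_] /=; [apply: Jg | apply: Js].
  exists r; rewrite mpolyXD gE big_ord_recl unlift_none /= mulrCA.
  by congr (_ * (_ * _)); apply: eq_bigr => j _; rewrite liftK.
by apply: ideal_genM; apply: sub_ideal_gen; exists g.
Qed.

End Packing.

(** * Monomial ideals and divisibility of monomials *)

Section MonomialIdeals.
Variables (K : fieldType) (n : nat).
Implicit Types (G : set (multinom n)) (b : multinom n).

Lemma monomial_genX G b g :
  G g -> (forall i, g i <= b i)%N -> monomial_gen (K := K) G (mpolyX K b).
Proof.
move=> Gg gb; have -> : b = mnm_add (mnm_sub b g) g.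
  by apply/mnmP => i; rewrite mnmDE mnmBE subnK.
by rewrite mpolyXD; apply/ideal_genM/sub_ideal_gen; exists g.
Qed.

Lemma msupp_monomial_gen G f b : monomial_gen (K := K) G f -> b \in msupp f ->
  exists2 g, G g & forall i, (g i <= b i)%N.
Proof.
move=> [r [c [h [Gh ->]]]] /msupp_sum_le /flatten_mapP[i _].
move=> /msuppM_le /allpairsP[[u v] /= [_ hv ->]].
have [g Gg hg] := Gh i; move: hv; rewrite -hg msuppX inE => /eqP ->.
by exists g => // j; rewrite mnmDE leq_addl.
Qed.

Lemma monomial_gen_sub G G' : (forall g, G g ->
    exists2 g', G' g' & forall i, (g' i <= g i)%N) ->
  monomial_gen (K := K) G `<=` monomial_gen G'.
Proof.
move=> GG' f [r [c [h [Gh ->]]]].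
have : forall i, exists g : multinom n * multinom n,
    G' g.2 /\ h i = mpolyX K (mnm_add g.1 g.2).
  move=> i; have [g Gg <-] := Gh i; have [g' Gg' g'g] := GG' g Gg.
  exists (mnm_sub g g', g'); split=> //=; congr mpolyX.
  by apply/mnmP => j; rewrite mnmDE mnmBE subnK.
move=> /choice[g hg]; exists r, (fun i => c i * mpolyX K (g i).1).
exists (fun i => mpolyX K (g i).2); split=> [i|]; first by exists (g i).2; case: (hg i).
by apply: eq_bigr => i _; case: (hg i) => _ ->; rewrite mpolyXD mulrA.
Qed.

End MonomialIdeals.

(** * Dickson's lemma and the exponent matrix *)

Section Dickson.

Lemma monotone_subseq (u : nat -> nat) : exists f : nat -> nat,
  {homo f : i j / (i < j)%N} /\ {homo u \o f : i j / (i <= j)%N}.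
Proof.
(* Each index of the subsequence minimizes [u] on the tail after the previous index, so the later
   values cannot be smaller. *)
have argmin N : exists k, (N <= k)%N /\ forall l, (N <= l)%N -> (u k <= u l)%N.
  have ex : exists v, `[< exists2 l, (N <= l)%N & u l = v >].
    by exists (u N); apply/asboolP; exists N.
  case: (ex_minnP ex) => v /asboolP[k Nk <-] kmin; exists k; split=> // l Nl.
  by apply: kmin; apply/asboolP; exists l.
have [g gP] := choice argmin.
pose f := fix f i := if i is j.+1 then g (f j).+1 else g 0%N.
have fS i : (f i < f i.+1)%N by case: (gP (f i).+1).
have uS i : (u (f i) <= u (f i.+1))%N.
  have [N [Nf fE]] : exists N, (N <= f i)%N /\ f i = g N.
    case: i => [|i]; first by exists 0%N.
    by exists (f i).+1; split=> //; apply: fS.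
  rewrite {1}fE; apply: (gP N).2; apply: leq_trans Nf _; exact: ltnW.
exists f; split; first by apply: homo_ltn fS => y x z; apply: ltn_trans.
by apply: homo_leq uS => [x|y x z]; [apply: leqnn | apply: leq_trans].
Qed.

Variable n : nat.
Implicit Types (G : set (multinom n)) (g h : multinom n) (s : seq (multinom n)).

Lemma multinom_good_seq (u : nat -> multinom n) :
  exists i j, (i < j)%N /\ forall l, (u i l <= u j l)%N.
Proof.
have [f [fi fu]] : exists f : nat -> nat, {homo f : i j / (i < j)%N} /\
    forall l, l \in enum 'I_n -> {homo (fun i => u (f i) l) : i j / (i <= j)%N}.
  (* Coordinates are treated one at a time; monotonicity in the earlier ones survives passage to a
     subsequence. *)
  elim: (enum 'I_n) => [|l0 r [f [fi fu]]]; first by exists id; split.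
  have [f' [fi' fu']] := monotone_subseq (fun i => u (f i) l0).
  exists (f \o f'); split=> [i j ij|l]; first by apply/fi/fi'.
  rewrite inE => /predU1P[-> //|lr] i j ij /=.
  by apply: fu => //; apply: ltnW_homo ij.
exists (f 0%N), (f 1%N); split; first exact: fi.
by move=> l; apply: (fu l (mem_enum _ l) 0%N 1%N).
Qed.

(** Otherwise one could choose forever an element of [G] that dominates none of those chosen before,
    contradicting [multinom_good_seq]. *)
Lemma multinom_finite_basis G : exists s, (forall g, g \in s -> G g) /\
  forall g, G g -> exists2 h, h \in s & forall i, (h i <= g i)%N.
Proof.
apply: contrapT => noS.
have next s : exists g, (forall h, h \in s -> G h) ->
    G g /\ forall h, h \in s -> ~ forall i, (h i <= g i)%N.
  have [sG|nsG] := pselect (forall h, h \in s -> G h); last by exists (@mnm0 n).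
  apply: contrapT => no; apply: noS; exists s; split=> // g Gg.
  apply: contrapT => nog; apply: no; exists g => _; split=> // h hs hg.
  by apply: nog; exists h.
have [f fP] := choice next.
(* [S k] lists the first [k] choices, so the sequence of choices is [f (S k)]. *)
pose S k := iter k (fun s => f s :: s) [::].
have SG k h : h \in S k -> G h.
  elim: k h => [//|k IHk] h; rewrite inE => /predU1P[->|]; last exact: IHk.
  by case: (fP _ IHk).
have [i [j [ij le_ij]]] := multinom_good_seq (fun k => f (S k)).
suff Sij : f (S i) \in S j by case: (fP _ (SG j)) => _ /(_ _ Sij).
elim: j ij {le_ij} => // j IHj; rewrite ltnS leq_eqVlt => /predU1P[->|/IHj].
  exact: mem_head.
by move=> Sij; rewrite inE Sij orbT.
Qed.

Lemma multinom_le_mdeg_eq g h :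
  (forall i, g i <= h i)%N -> (mdeg h <= mdeg g)%N -> g = h.
Proof.
move=> gh; have -> : h = mnm_add (mnm_sub h g) g.
  by apply/mnmP => i; rewrite mnmDE mnmBE subnK.
rewrite mdegD -[leqRHS]add0n leq_add2r leqn0 mdeg_eq0 => /eqP ->.
by apply/mnmP => i; rewrite mnmDE mnm0E.
Qed.

Lemma dickson G : exists s,
  [/\ uniq s, forall g, g \in s -> G g,
      forall g, G g -> exists2 h, h \in s & forall i, (h i <= g i)%N &
      forall g h, g \in s -> h \in s -> (forall i, h i <= g i)%N -> h = g].
Proof.
have [s [sG Gs]] := multinom_finite_basis G.
pose minimal g := `[< forall h, h \in s -> (forall i, h i <= g i)%N -> h = g >].
exists [seq g <- undup s | minimal g]; split.
- exact/filter_uniq/undup_uniq.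
- by move=> g; rewrite mem_filter mem_undup => /andP[_ /sG].
- move=> g /Gs[h0 h0s h0g].
  have ex : exists d, has (fun h => `[< forall i, (h i <= g i)%N >] && (mdeg h == d)) s.
    by exists (mdeg h0); apply/hasP; exists h0 => //; rewrite eqxx andbT; apply/asboolP.
  case: (ex_minnP ex) => d /hasP[h hs /andP[/asboolP hg /eqP hd]] dmin.
  exists h => //; rewrite mem_filter mem_undup hs andbT; apply/asboolP => k ks kh.
  apply: multinom_le_mdeg_eq => //; rewrite hd; apply: dmin; apply/hasP; exists k => //.
  by rewrite eqxx andbT; apply/asboolP => i; apply: leq_trans (hg i).
- move=> g h; rewrite !mem_filter !mem_undup => /andP[/asboolP gmin _] /andP[_ hs].
  exact: gmin.
Qed.

End Dickson.

(** The columns are the antichain given by [dickson]. A generating subset must have an element below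
    each column, and in an antichain this element is the column itself. *)
Lemma exponent_matrixP (K : fieldType) n (I : set (mpoly n K)) :
  monomial_ideal I -> is_exponent_matrix I (tagged (exponent_matrix I)).
Proof.
move=> [G IG]; suff ex : exists M, [set M | is_exponent_matrix I (tagged M)] M.
  exact: (xgetPex _ ex).
have [s [us sG Gs smin]] := dickson G.
pose M : 'M[nat]_(n, size s) := \matrix_(i, j) (nth (@mnm0 n) s j) i.
have colM : [set a : multinom n | exists j, forall i, a i = M i j] = [set` s].
  apply/seteqP; split=> [a [j aM]|a /= /(nthP (@mnm0 n))[j js <-]].
    have -> : a = nth (@mnm0 n) s j by apply/mnmP => i; rewrite aM mxE.
    exact: mem_nth.
  by exists (Ordinal js) => i; rewrite mxE.
exists (Tagged (fun m => 'M[nat]_(n, m)) M) => /=; split=> [j k jk|].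
  apply/val_inj/eqP; rewrite -(nth_uniq (@mnm0 n) (ltn_ord j) (ltn_ord k) us).
  apply/eqP/mnmP => i.
  by have /matrixP/(_ i ord0) := jk; rewrite !mxE.
rewrite colM; split=> [|G' G's IG'].
  rewrite IG; apply/seteqP; split; apply: monomial_gen_sub => g.
    exact: Gs.
  by move=> gs; exists g => //; apply: sG.
apply/seteqP; split=> // g gs.
have Ig : I (mpolyX K g) by rewrite IG; apply: (monomial_genX K (sG _ gs)) => i.
have gg : g \in msupp (mpolyX K g) by rewrite msuppX mem_head.
rewrite IG' in Ig; have [g' G'g' g'g] := msupp_monomial_gen Ig gg.
by rewrite -(smin g g' gs (G's _ G'g') g'g).
Qed.

(** * Fractional packings *)

Section Approximation.
Variable R : realType.

(** Dirichlet's theorem: [N] is the difference of two multipliers for which the fractional parts of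
    the multiples of [y] nearly agree. *)
Lemma simultaneous_approximation (T : finType) (y : T -> R) (q : nat) :
  (forall j, 0 <= y j) ->
  exists (N : nat) (p : T -> nat), (0 < N)%N /\
    forall j, `|N%:R * y j - (p j)%:R| < q.+1%:R^-1.
Proof.
move=> y0; pose frac (t : nat) j : R := t%:R * y j - (Num.truncn (t%:R * y j))%:R.
have ty0 (t : nat) j : 0 <= t%:R * y j by rewrite mulr_ge0.
have q0 : 0 < q.+1%:R :> R by rewrite ltr0n.
have frac_itv t j : 0 <= q.+1%:R * frac t j < q.+1%:R.
  have /andP[le_t lt_t] := truncn_itv (ty0 t j).
  by rewrite mulr_ge0 ?ler0n ?subr_ge0 //= gtr_pMr // ltrBlDl natr1.
pose f (t : 'I_(q.+1 ^ #|T|).+1) : {ffun T -> 'I_q.+1} :=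
  [ffun j => inord (Num.truncn (q.+1%:R * frac t j))].
(* The scaled fractional part is below q + 1, so [inord] does not take its default value. *)
have ffrac u j : (f u j)%:R <= q.+1%:R * frac u j < (f u j).+1%:R.
  have /andP[fr0 fr1] := frac_itv u j.
  by rewrite ffunE inordK ?truncn_itv // truncn_lt_nat.
(* Pigeonhole on the cells of side 1/(q+1) containing the fractional parts. *)
have [t1 [t2 [lt12 f12]]] : exists t1 t2 : 'I_(q.+1 ^ #|T|).+1, (t1 < t2)%N /\ f t1 = f t2.
  have /injectivePn[t1 [t2 ne12 f12]] : ~~ injectiveb f.
    apply/injectiveP => /leq_card; rewrite card_ffun !card_ord.
    by rewrite ltnn.
  case: (ltngtP t1 t2) => [lt12|lt21|/val_inj eq12].
  - by exists t1, t2.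
  - by exists t2, t1.
  - by rewrite eq12 eqxx in ne12.
(* The truncated subtraction is exact: [y j] is nonnegative and t1 < t2. *)
pose p j := (Num.truncn (t2%:R * y j) - Num.truncn (t1%:R * y j))%N.
exists (t2 - t1)%N, p; split=> [|j]; first by rewrite subn_gt0.
have -> : (t2 - t1)%N%:R * y j - (p j)%:R = frac t2 j - frac t1 j.
  rewrite !natrB ?(ltnW lt12) //; last first.
    by apply/le_truncn/ler_wpM2r => //; rewrite ler_nat ltnW.
  by rewrite /frac mulrBl !opprD !opprK addrACA.
have /andP[l1 u1] := ffrac t1 j; have /andP[l2 u2] := ffrac t2 j.
rewrite -(ltr_pM2l q0) mulfV ?gt_eqF // -[X in X * `|_|]ger0_norm ?ltW // -normrM.
rewrite mulrBr ltr_distl ltrBlDr; rewrite f12 -[X in _ < X]natr1 in u1 l1.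
rewrite -[X in _ < X]natr1 in u2.
by rewrite (lt_le_trans u1) ?lerD2r //= (lt_le_trans u2) // lerD2r.
Qed.

End Approximation.

Section FractionalPacking.
Variables (R : realType) (n m : nat) (M : 'M[nat]_(n, m)).
Implicit Types (b : multinom n).

Local Notation MR := (map_mx (fun e : nat => e%:R : R) M).

Lemma map_mulmx_colE (y : 'cV[R]_m) i :
  (MR *m y) i ord0 = \sum_(j < m) (M i j)%:R * y j ord0.
Proof. by rewrite mxE; apply: eq_bigr => j _; rewrite mxE. Qed.

Lemma fractional_of_packing b s N : (0 < N)%N ->
  packing_values M (mnm_muln b N) (N * s)%N ->
  fractional_packing_values (R := R) M b s%:R.
Proof.
move=> N0 [y [Mb sy]]; have NR : 0 < N%:R :> R by rewrite ltr0n.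
exists (\col_j ((y j ord0)%:R / N%:R)); split=> [j|i|].
- by rewrite mxE divr_ge0.
- rewrite map_mulmx_colE; under eq_bigr do rewrite mxE mulrA.
  rewrite -mulr_suml ler_pdivrMr // -natrM -mulmnE.
  under eq_bigr do rewrite -natrM.
  by rewrite -natr_sum ler_nat -mulmx_nat_colE.
- under eq_bigr do rewrite mxE.
  by rewrite -mulr_suml -natr_sum -sy natrM mulrAC mulfV ?mul1r // gt_eqF.
Qed.

Lemma packing_of_fractional b r k : k%:R <= r ->
  fractional_packing_values (R := R) M b r ->
  exists2 N, (0 < N)%N & packing_values M (mnm_muln b N) (N * k)%N.
Proof.
move=> kr [y [y0 Mb ry]].
(* With q + 1 above [m] and above every row sum of [M], the total errors in |p| and in each row of M
   p stay below 1. *)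
pose q := (m + \sum_i \sum_j M i j)%N.
have [N [p [N0 Np]]] := simultaneous_approximation q y0.
have q0 : 0 < q.+1%:R :> R by rewrite ltr0n.
exists N => //; apply: (@packing_values_geq _ _ _ _ (\sum_j p j)%N).
  (* Between integers, it is enough that N k - |p| < 1 over the reals. *)
  rewrite -ltnS -(ltr_nat R) -natr1 natrM natr_sum -ltrBlDl.
  have lt1 : N%:R * r - \sum_j (p j)%:R < 1.
    rewrite ry mulr_sumr -sumrB.
    apply: (@le_lt_trans _ _ (\sum_(j < m) q.+1%:R^-1)).
      by apply: ler_sum => j _; apply: le_trans (ltW (Np j)); apply: ler_norm.
    rewrite sumr_const card_ord -[ltLHS]mulr_natl ltr_pdivrMr // mul1r ltr_nat ltnS.
    exact: leq_addr.
  by apply: le_lt_trans lt1; rewrite lerD2r ler_wpM2l.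
exists (\col_j p j); split=> [i|]; last by apply: eq_bigr => j _; rewrite mxE.
rewrite mulmx_nat_colE mulmnE -ltnS -(ltr_nat R) -natr1 natrM natr_sum -ltrBlDl.
under eq_bigr do rewrite mxE natrM.
(* As M y <= b, the excess of M p over N b is at most M (p - N y). *)
apply: (@le_lt_trans _ _ (\sum_(j < m) (M i j)%:R * ((p j)%:R - N%:R * y j ord0))).
  under [leRHS]eq_bigr do rewrite mulrBr.
  rewrite sumrB lerD2l lerN2; under eq_bigr do rewrite mulrCA.
  by rewrite -mulr_sumr [leRHS]mulrC ler_wpM2l // -map_mulmx_colE.
apply: (@le_lt_trans _ _ (\sum_(j < m) (M i j)%:R * q.+1%:R^-1)).
  apply: ler_sum => j _; rewrite ler_wpM2l //; apply: le_trans (ltW (Np j)).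
  by rewrite distrC ler_norm.
rewrite -mulr_suml ltr_pdivrMr // mul1r -natr_sum ltr_nat ltnS /q (bigD1 i) //=.
by rewrite addnCA leq_addr.
Qed.

Hypothesis M_neq0 : forall j, exists i, (0 < M i j)%N.

Lemma packing_values_max b :
  exists s, packing_values M b s /\ ubound (packing_values M b) s.
Proof.
(* A positive entry [M i j] forces y j <= b i <= |b|. *)
have bnd s : `[< packing_values M b s >] -> (s <= m * mdeg b)%N.
  move=> /asboolP[y [Mb ->]].
  have -> : (m * mdeg b = \sum_(j < m) mdeg b)%N by rewrite sum_nat_const card_ord.
  apply: leq_sum => j _; have [i Mij] := M_neq0 j.
  apply: (@leq_trans (b i)); last by rewrite mdegE (bigD1 i) //= leq_addr.
  apply: leq_trans (Mb i); rewrite mulmx_nat_colE (bigD1 j) //=.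
  by rewrite (leq_trans _ (leq_addr _ _)) // leq_pmull.
have ex : exists s, `[< packing_values M b s >].
  by exists 0%N; apply/asboolP; apply: packing_values0.
case: (ex_maxnP ex bnd) => s /asboolP ps smax; exists s; split=> // t pt.
by apply: smax; apply/asboolP.
Qed.

Lemma fractional_packing_values_max b : exists s,
  fractional_packing_values (R := R) M b s /\ ubound (fractional_packing_values (R := R) M b) s.
Proof.
(* The same bound y j <= |b| puts the feasible set, transposed to row vectors, inside this compact
   box. *)
pose box : set 'rV[R]_m :=
  [set v | forall j, `[0, (mdeg b)%:R]%classic (v ord0 j)].
pose P : set 'rV[R]_m := box `&` \bigcap_i
  (fun v : 'rV[R]_m => \sum_j (M i j)%:R * v ord0 j) @^-1` [set x | x <= (b i)%:R].
have sum_continuous (c : 'I_m -> R) :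
    continuous (fun v : 'rV[R]_m => \sum_j c j * v ord0 j).
  apply: continuous_big => [|j _]; first exact: add_continuous.
  by move=> v; apply: continuousM; [apply: cst_continuous | apply: coord_continuous].
have cptP : compact P.
  apply: compact_closedI.
    by apply: (rV_compact (A := fun=> _)) => j; apply: segment_compact.
  apply: closed_bigI => i _; apply: preimage_closed; last exact: closed_le.
  by move=> v _; exact: sum_continuous.
have inP (y : 'cV[R]_m) : (forall j, 0 <= y j ord0) ->
    (forall i, (MR *m y) i ord0 <= (b i)%:R) -> P y^T.
  move=> y0 My; split=> [j|i _] /=; last first.
    by under eq_bigr do rewrite mxE; rewrite -map_mulmx_colE.
  rewrite mxE in_itv /= y0 /=; have [i Mij] := M_neq0 j.
  apply: (@le_trans _ _ (b i)%:R); last first.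
    by rewrite ler_nat mdegE (bigD1 i) //= leq_addr.
  apply: le_trans (My i); rewrite map_mulmx_colE (bigD1 j) //= -[leLHS]addr0.
  rewrite lerD ?sumr_ge0 // => [|k _]; last by rewrite mulr_ge0.
  by rewrite ler_peMl // ler1n.
(* The coefficients 1 make the objective an instance of [sum_continuous]. *)
have [||v vP vmax] := EVT_max_rV (f := fun v : 'rV[R]_m => \sum_j 1 * v ord0 j) _ cptP.
- by exists (0 : 'cV[R]_m)^T; apply: inP => *; rewrite ?mulmx0 !mxE.
- exact/continuous_subspaceT/sum_continuous.
exists (\sum_j 1 * v ord0 j); split.
  have [vbox vM] := set_mem vP; exists v^T; split=> [j|i|].
  - by have := vbox j; rewrite /= in_itv /= mxE => /andP[].
  - rewrite map_mulmx_colE; under eq_bigr do rewrite mxE.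
    exact: (vM i).
  - by apply: eq_bigr => j _; rewrite mxE mul1r.
move=> _ [y [y0 My ->]]; have := vmax _ (mem_set (inP y y0 My)).
by under eq_bigr do rewrite mxE mul1r.
Qed.

End FractionalPacking.

Lemma le_set_max d (T : porderType d) (x0 x : T) (B : set T) :
  (exists s, B s /\ ubound B s) ->
  (x <= set_max x0 B)%O <-> exists2 s, B s & (x <= s)%O.
Proof.
move=> maxB; have [Bm ubm] := xgetPex x0 maxB; split=> [xm|[s Bs xs]].
  by exists (set_max x0 B).
exact: le_trans xs (ubm _ Bs).
Qed.

(** * Membership of a monomial *)

Section Membership.
Variables (K : fieldType) (n m : nat) (M : 'M[nat]_(n, m)).
Variable I : set (mpoly n K).
Hypothesis I_gen :
  I = monomial_gen [set a : multinom n | exists j, forall i, a i = M i j].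
Implicit Types b : multinom n.

Lemma msupp_exponent_matrix f : I f ->
  forall b, b \in msupp f -> packing_values M b 1.
Proof.
rewrite I_gen => If b /(msupp_monomial_gen If)[g [j gM] gb].
by apply/packing_values1; exists j => i; rewrite -gM.
Qed.

Lemma mpolyX_exponent_matrix b : packing_values M b 1 -> I (mpolyX K b).
Proof.
move=> /packing_values1[j Mb]; rewrite I_gen.
pose g := Multinom [tuple M i j | i < n].
apply: (@monomial_genX K n _ b g) => [|i]; last by rewrite mnmE.
by exists j => i; rewrite mnmE.
Qed.

(** A zero column would be the exponent of the generator 1. *)
Lemma exponent_matrix_col_neq0 j : I <> setT -> exists i, (0 < M i j)%N.
Proof.
move=> IT; apply: contrapT => Mj; apply: IT; rewrite I_gen; apply: ideal_gen1.
rewrite -/(monomial_gen _) -I_gen -mpolyX0; apply: mpolyX_exponent_matrix.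
apply/packing_values1; exists j => i; rewrite leqNgt; apply/negP => Mij.
by apply: Mj; exists i; apply: leq_ltn_trans Mij.
Qed.

Lemma ideal_pow_mpolyXP b k : ideal_pow I k (mpolyX K b) <-> packing_values M b k.
Proof.
split=> [Ib|pb].
  rewrite -[k]muln1; apply: (msupp_ideal_pow msupp_exponent_matrix Ib).
  by rewrite msuppX mem_head.
apply: (mpolyX_ideal_pow mpolyX_exponent_matrix); by rewrite muln1.
Qed.

Lemma integral_closure_mpolyXP b k :
  integral_closure (ideal_pow I k) (mpolyX K b) <->
  exists2 N, (0 < N)%N & packing_values M (mnm_muln b N) (N * k)%N.
Proof.
split=> [[d [c [d0 Jc eq0]]]|[N N0 pb]]; last first.
  apply: (integral_closure_pow N0); rewrite mpolyXn.
  by apply: mpolyX_ideal_pow pb => c /ideal_pow_mpolyXP.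
(* Compare the coefficients of x^(d b). *)
have [i [id ci]] : exists i, (1 <= i <= d)%N /\ mcoeff (mnm_muln b i) (c i) != 0.
  apply: contrapT => noi; have := congr1 (mcoeff (mnm_muln b d)) eq0.
  rewrite mcoeffD mpolyXn mcoeffX eqxx mcoeff0 raddf_sum big_nat big1 ?addr0.
    by move/eqP; rewrite oner_eq0.
  move=> i /andP[i0 id] /=; rewrite ltnS in id.
  (* The coefficient of x^(d b) in c_i x^((d-i) b) is that of x^(i b) in c_i. *)
  have -> : mnm_muln b d = mnm_add (mnm_muln b (d - i)) (mnm_muln b i).
    by apply/mnmP => l; rewrite mnmDE !mulmnE -mulnDr subnK.
  rewrite mpolyXn mcoeffMX; apply/eqP/negPn/negP => ci; apply: noi; exists i.
  by rewrite i0 id.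
exists i; first by case/andP: id.
(* Since c_i lies in (I^k)^i, its monomial x^(i b) carries a packing of size i k. *)
apply: (msupp_ideal_pow _ (Jc i id)); last by rewrite mcoeff_msupp.
move=> f If; rewrite -[k]muln1.
exact: (msupp_ideal_pow msupp_exponent_matrix If).
Qed.

End Membership.

Theorem proposition1p1 (R : realType) (K : fieldType) (n : nat)
    (I : set (mpoly n K)) (a : multinom n) (k : nat) :
  monomial_ideal I -> (1 <= k)%N ->
  (ideal_pow I k (mpolyX K a) <-> ((k%:Z)%:E <= nu I a)%E) /\
  (integral_closure (ideal_pow I k) (mpolyX K a) <->
    ((k%:R)%:E <= nustar R I a)%E).
Proof.
move=> /exponent_matrixP; rewrite /nu /nustar.
case: (exponent_matrix I) => m M /= [_ [I_gen _]] k0.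
case: asboolP => [IT|IT].
  (* For I = R both values are +oo and all powers equal R; an equation of degree 1 shows
     integrality. *)
  rewrite !leey; split; split=> // _; first by rewrite (ideal_powT _ IT).
  by apply: (@integral_closure_pow _ _ 1) => //; rewrite !ideal_powT.
have M_neq0 j := exponent_matrix_col_neq0 I_gen j IT.
rewrite !lee_fin lez_nat -leEnat; split.
  apply: iff_trans _ (iff_sym (le_set_max _ _ (packing_values_max M_neq0 a))).
  apply: iff_trans (ideal_pow_mpolyXP I_gen a k) _.
  split=> [pk|[s ps ks]]; first by exists k.
  exact: packing_values_geq ks ps.
apply: iff_trans _ (iff_sym (le_set_max _ _ (fractional_packing_values_max R M_neq0 a))).
apply: iff_trans (integral_closure_mpolyXP I_gen a k) _.
split=> [[N N0 pN]|[s ps ks]]; last exact: packing_of_fractional ks ps.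
by exists k%:R => //; apply: fractional_of_packing N0 pN.
Qed.
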